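(* Let $n\ge1$. Suppose that for every convex bounded set $M\subset\mathbb{R}^n$ containing the origin, every concave function $g:M\longrightarrow\mathbb{R}_{\ge0}$ with $g(0)=|g|_\infty$, and all $0<p<q$, the inequality \[ \left(\frac{\binom{n+q}{n}}{\mathrm{G}_{n}(M)}\sum_{x\in M\cap\mathbb{Z}^n}g^{q}(x)\right)^{1/q} \leq\left(\frac{\binom{n+p}{n}}{\mathrm{G}_{n}(M)}\sum_{x\in (M+(-1,1)^n)\cap\mathbb{Z}^n} \bigl(g^{\diamond}\bigr)^{p}(x)\right)^{1/p} \] holds. Then, for every compact convex set $K\subset\mathbb{R}^n$ with $\dim K=n$, every concave function $f:K\longrightarrow\mathbb{R}_{\geq0}$, and all $0<p<q$, \[ \left(\frac{\binom{n+q}{n}}{\mathrm{vol}(K)}\int_{K}f^{q}(x)\,\mathrm{d} x\right)^{1/q} \leq\left(\frac{\binom{n+p}{n}}{\mathrm{vol}(K)}\int_{K}f^{p}(x)\,\mathrm{d} x\right)^{1/p}. \]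
   Context: For $M\subset\mathbb{R}^n$, $\mathrm{G}_n(M)=|M\cap\mathbb{Z}^n|$; $\mathrm{vol}$ is $n$-dimensional Lebesgue measure; $\dim$ of a set is the dimension of its affine hull. $|g|_\infty=\sup_{x\in M}g(x)$. For real $r,s>0$, $\binom{r}{s}=\frac{\Gamma(r+1)}{\Gamma(s+1)\Gamma(r-s+1)}$. For $\phi:M\to\mathbb{R}_{\ge0}$, let $\overline{\phi}:\mathbb{R}^n\to\mathbb{R}_{\ge0}$ equal $\phi$ on $M$ and $0$ elsewhere; then $\phi^{\diamond}:M+(-1,1)^n\to\mathbb{R}_{\ge0}$ is $\phi^{\diamond}(z)=\sup_{u\in(-1,1)^n}\overline{\phi}(z+u)$. Sums of sets are Minkowski sums. The theorem asserts that the discrete inequality implies its continuous counterpart (Berwald's inequality). *)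

(* Defs.v *)
From HB Require Import structures.
From mathcomp Require Import all_boot all_order all_algebra.
From mathcomp Require Import finmap.
From mathcomp Require Import all_classical all_reals all_analysis.

Set Implicit Arguments.
Unset Strict Implicit.
Unset Printing Implicit Defensive.

Import Order.TTheory GRing.Theory Num.Theory.
Import numFieldNormedType.Exports.

Local Open Scope classical_set_scope.
Local Open Scope ring_scope.
Local Open Scope convex_scope.

Section rV_measurable.
Context {R : realType} {n : nat}.

Let coords : 'I_n -> 'rV[R]_n -> measurableTypeR R := fun i v => v ord0 i.

Let rV_set0 : g_sigma_preimage coords set0.
Proof. exact: sigma_algebra0. Qed.

Let rV_setC A : g_sigma_preimage coords A -> g_sigma_preimage coords (~` A).
Proof. exact: sigma_algebraC. Qed.

Let rV_bigcup (F : _^nat) : (forall i, g_sigma_preimage coords (F i)) ->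
  g_sigma_preimage coords (\bigcup_i (F i)).
Proof. exact: sigma_algebra_bigcup. Qed.

(* The Borel sigma-algebra of R^n, generated by the coordinate functions. *)
HB.instance Definition _ := @isMeasurable.Build
  (measure_tuple_display (R.-ocitv.-measurable).-sigma)
  'rV[R]_n (g_sigma_preimage coords) rV_set0 rV_setC rV_bigcup.

Lemma measurable_coord (i : 'I_n) :
  measurable_fun [set: 'rV[R]_n] (fun v => v ord0 i : measurableTypeR R).
Proof.
move=> _ Y mY; rewrite setTI; apply: sub_sigma_algebra => /=.
rewrite -bigcup_seq/=; exists i => /=; first by rewrite mem_index_enum.
by exists Y => //; rewrite setTI.
Qed.

Lemma measurable_fun_coordP d (T : measurableType d) (f : T -> 'rV[R]_n) :
  (forall i, measurable_fun [set: T] (fun t => f t ord0 i : measurableTypeR R)) ->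
  measurable_fun [set: T] f.
Proof.
move=> mf.
have sub : g_sigma_preimage (fun i => coords i \o f) `<=` measurable.
  apply: smallest_sub; first exact: sigma_algebra_measurable.
  rewrite -bigcup_seq => A [/= i _ [B mB <-]].
  exact: mf.
by move=> _ A mA; apply: sub; rewrite g_sigma_preimage_comp; exists A.
Qed.

End rV_measurable.

Section lebesgue_rV.
Context {R : realType}.

Definition cons_rV n (p : measurableTypeR R * 'rV[R]_n) : 'rV[R]_n.+1 :=
  row_mx (p.1%:M : 'rV[R]_1) p.2.

Definition uncons_rV n (v : 'rV[R]_n.+1) : measurableTypeR R * 'rV[R]_n :=
  (v ord0 ord0, rsubmx (v : 'rV[R]_(1 + n))).

Lemma cons_rVK n : cancel (@cons_rV n) (@uncons_rV n).
Proof.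
move=> [x v]; congr (_, _); last exact: row_mxKr.
have -> : (ord0 : 'I_n.+1) = lshift n (ord0 : 'I_1) by exact: val_inj.
by rewrite [LHS]row_mxEl mxE.
Qed.

Lemma measurable_cons_rV n : measurable_fun setT (@cons_rV n).
Proof.
apply: measurable_fun_coordP => i.
have [j ->|j ->] := @split_ordP 1 n i.
  apply: eq_measurable_fun (measurable_fst) => p _.
  by rewrite (ord1 j) [RHS]row_mxEl mxE.
apply: eq_measurable_fun (measurableT_comp (measurable_coord j) measurable_snd).
by move=> p _; rewrite [RHS]row_mxEr.
Qed.

Lemma measurable_uncons_rV n : measurable_fun setT (@uncons_rV n).
Proof.
apply: measurable_fun_pair; first exact: measurable_coord.
apply: measurable_fun_coordP => i.
apply: eq_measurable_fun (measurable_coord (rshift 1 i : 'I_n.+1)) => v _.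
by rewrite mxE.
Qed.

HB.instance Definition _ n :=
  isMeasurableFun.Build _ _ _ _ (@cons_rV n) (@measurable_cons_rV n).

Section step.
Context n (m : {sigma_finite_measure set 'rV[R]_n -> \bar R}).

Definition lebesgue_rV_step : set 'rV[R]_n.+1 -> \bar R :=
  pushforward (@lebesgue_measure R \x m)%E (@cons_rV n).

Let step0 : lebesgue_rV_step set0 = 0%E.
Proof. exact: measure0. Qed.

Let step_ge0 A : (0 <= lebesgue_rV_step A)%E.
Proof. exact: measure_ge0. Qed.

Let step_sigma_additive : semi_sigma_additive lebesgue_rV_step.
Proof. exact: measure_semi_sigma_additive. Qed.

HB.instance Definition _ := isMeasure.Build _ _ _
  lebesgue_rV_step step0 step_ge0 step_sigma_additive.

Let step_sigma_finite : sigma_finite setT lebesgue_rV_step.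
Proof.
have /sigma_finiteP[F [TF ndF Foo]] := sigma_finiteT (@lebesgue_measure R).
have /sigma_finiteP[G [TG ndG Goo]] := sigma_finiteT m.
exists (fun k => @uncons_rV n @^-1` (F k `*` G k)).
  rewrite -preimage_bigcup (_ : \bigcup_k _ = setT) ?preimage_setT//.
  apply/seteqP; split=> // -[x v] _.
  have [k _ Fx] : (\bigcup_k F k) x by rewrite -TF.
  have [l _ Gv] : (\bigcup_k G k) v by rewrite -TG.
  exists (maxn k l) => //; split=> /=.
    by move: x Fx; exact/subsetPset/ndF/leq_maxl.
  by move: v Gv; exact/subsetPset/ndG/leq_maxr.
move=> k; have [mF Fk] := Foo k; have [mG Gk] := Goo k; split.
  rewrite -[X in measurable X]setTI.
  by apply: measurable_uncons_rV => //; exact: measurableX.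
rewrite /lebesgue_rV_step /pushforward -comp_preimage.
rewrite (_ : _ \o _ = id); last by apply/funext/cons_rVK.
by rewrite preimage_id product_measure1E// lte_mul_pinfty// ge0_fin_numE.
Qed.

HB.instance Definition _ := @Measure_isSigmaFinite.Build _ _ _
  lebesgue_rV_step step_sigma_finite.

End step.

(* Lebesgue measure on R^n, as the n-fold product of the one-dimensional one
   transported along R * R^n -> R^(n+1); R^0 carries a unit mass.  It lives on
   the Borel sets, but the library integral of a nonnegative function is the
   supremum over its simple Borel minorants, which is also the right value for
   functions that are only Lebesgue measurable, such as a concave function on a
   compact convex set (it may fail to be Borel on the boundary). *)
Fixpoint lebesgue_rV n : {sigma_finite_measure set 'rV[R]_n -> \bar R} :=
  if n is n'.+1 then lebesgue_rV_step (lebesgue_rV n') else \d_(0 : 'rV[R]_0).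

End lebesgue_rV.
Arguments lebesgue_rV {R} n.

Lemma lebesgue_rV_box {R : realType} n (A : 'I_n -> set (measurableTypeR R)) :
  (forall i, measurable (A i)) ->
  lebesgue_rV n [set v | forall i, A i (v ord0 i)] =
  (\prod_(i < n) lebesgue_measure (A i))%E.
Proof.
elim: n A => [|n IH] A mA.
  by rewrite big_ord0/= diracE mem_set//= => -[].
pose A' (i : 'I_n) := A (lift ord0 i).
have mA' i : measurable (A' i) by exact: mA.
have mB : measurable [set v : 'rV[R]_n | forall i, A' i (v ord0 i)].
  rewrite (_ : mkset _ = \big[setI/setT]_(i < n)
      ((fun v : 'rV[R]_n => v ord0 i : measurableTypeR R) @^-1` A' i)).
    apply: bigsetI_measurable => i _; rewrite -[X in measurable X]setTI.
    exact: measurable_coord.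
  rewrite -bigcap_seq; apply/seteqP; split => v /= Av i => [_|]; first exact: Av.
  by apply: (Av i); exact: mem_index_enum.
rewrite big_ord_recl -IH//= -product_measure1E//.
rewrite /lebesgue_rV_step /pushforward; congr (_ _).
have c0 p : @cons_rV R n p ord0 ord0 = p.1.
  by have := cons_rVK p => /(congr1 fst).
have cS p i : @cons_rV R n p ord0 (lift ord0 i) = p.2 ord0 i.
  have -> : lift ord0 i = rshift 1 i :> 'I_n.+1 by exact: val_inj.
  exact: row_mxEr.
apply/seteqP; split => p /= Ap.
  by split=> [|i]; [have := Ap ord0; rewrite c0|have := Ap (lift ord0 i); rewrite cS].
move: Ap => [Ap0 ApS] i.
by case: (unliftP ord0 i) => [j|] ->; rewrite ?cS ?c0//; exact: ApS.
Qed.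

Section lattice.
Context {R : realType} {n : nat}.
Implicit Types (M D : set 'rV[R]_n) (phi : 'rV[R]_n -> R).

Definition Zlattice : set 'rV[R]_n := [set x | forall i, x ord0 i \is a Num.int].

(* Only meaningful when M contains finitely many lattice points, e.g. when M
   is bounded. *)
Definition lattice_count M : nat := #|` fset_set (M `&` Zlattice)|.

Definition open_cube : set 'rV[R]_n := [set u | forall i, -1 < u ord0 i < 1].

Definition minkowski_sum (A B : set 'rV[R]_n) : set 'rV[R]_n :=
  [set x + y | x in A & y in B].

(* Functions on M are total functions whose values outside M are ignored. The
   supremum is taken in R and is only meaningful when phi is bounded above on M,
   which holds for every nonnegative concave function on a bounded convex set. *)
Definition diamond M phi (z : 'rV[R]_n) : R :=
  sup [set patch (fun=> 0) M phi (z + u) | u in open_cube].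

Definition supremum_on M phi : \bar R := ereal_sup [set (phi x)%:E | x in M].

Definition nonneg_on M phi := {in M, forall x, 0 <= phi x}.

Definition concave_function (D : set (convex_lmodType 'rV[R]_n))
    (phi : convex_lmodType 'rV[R]_n -> R^o) :=
  forall t : {i01 R},
    {in D &, forall x y, phi x <| t |> phi y <= phi (x <| t |> y)}.

Definition affine_hull M : set 'rV[R]_n :=
  [set x | exists (m : nat) (a : 'I_m -> 'rV[R]_n) (w : 'I_m -> R),
     [/\ forall i, M (a i), \sum_i w i = 1 & x = \sum_i w i *: a i]].

(* The dimension is a relation; the empty set has none. *)
Definition has_dim M (d : nat) :=
  exists (x0 : 'rV[R]_n) (V : {vspace 'rV[R]_n}),
    affine_hull M = [set x0 + v | v in [set` V]] /\ \dim V = d.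

End lattice.

Section gamma.
Context {R : realType}.
Implicit Types r s : R.

Definition Gamma s : R :=
  \int[lebesgue_measure]_(t in `]0, +oo[) (t `^ (s - 1) * expR (- t)).

Definition rbinomial r s : R :=
  Gamma (r + 1) / (Gamma (s + 1) * Gamma (r - s + 1)).

End gamma.

(* Main.v *)
(* Fix E > 1 and a point c of K, interior to K, where f is within a factor E of
   its supremum.  The discrete inequality is applied to the dilate
   M = lam (K - c) and to the truncation min (f, f c) carried over to M, which
   attains its maximum at 0.  By convexity, the homothety of center c and ratio
   1/E sends every point at distance at most (E - 1) r from K into K, where r is
   the size of a cube around c inside K, and by concavity it divides f by at most
   E.  Hence, for lam large, the lattice sums over M and K-integrals of f
   dominate each other up to powers of E, when the lattice cells have side E/lam
   for one direction and 1/(lam E) for the other.  Finally E tends to 1. *)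

Require Import Defs.
From mathcomp Require Import all_boot all_order all_algebra.
From mathcomp Require Import finmap.
From mathcomp Require Import all_classical all_reals all_analysis.
From mathcomp Require Import measurable_realfun zify ring lra.
Set Implicit Arguments.
Unset Strict Implicit.
Unset Printing Implicit Defensive.
Import Order.TTheory GRing.Theory Num.Theory.
Import numFieldNormedType.Exports.
Local Open Scope classical_set_scope.
Local Open Scope ring_scope.

(* No measurability is needed: the integral is a supremum over simple minorants. *)
Lemma ge0_le_integral_restrict d (T : measurableType d) (R : realType)
    (mu : {measure set T -> \bar R}) (D E : set T) (f g : T -> \bar R) :
  (forall x, D x -> 0 <= f x)%E -> (forall x, E x -> 0 <= g x)%E ->
  (forall x, (f \_ D) x <= (g \_ E) x)%E ->
  (\int[mu]_(x in D) f x <= \int[mu]_(x in E) g x)%E.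
Proof.
move=> f0 g0 fg; rewrite !ge0_integralE//; apply: le_ereal_sup => _ [h hf <-].
by exists h => // x; exact: le_trans (hf x) (fg x).
Qed.

(** * Lattice cells: lattice sums compared with integrals *)

Section cells.
Context {R : realType} {n : nat}.
Implicit Types (c w y : 'rV[R]_n) (K S : set 'rV[R]_n) (d : R).

(** Half-open, so that for [d > 0] the cells of the lattice points [y] tile the space. *)
Definition cell c d y : set 'rV[R]_n :=
  [set w | forall i, w ord0 i \in
     `[c ord0 i + d * y ord0 i, c ord0 i + d * (y ord0 i + 1)[].

Lemma measurable_box (A : 'I_n -> set (measurableTypeR R)) :
  (forall i, measurable (A i)) ->
  measurable [set v : 'rV[R]_n | forall i, A i (v ord0 i)].
Proof.
move=> mA; rewrite (_ : mkset _ = \bigcap_(i in [set: 'I_n])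
    ((fun v : 'rV[R]_n => v ord0 i : measurableTypeR R) @^-1` A i)).
  apply: fin_bigcap_measurable => // i _; rewrite -[X in measurable X]setTI.
  exact: measurable_coord.
by apply/seteqP; split => v /= Av i => [_|]; exact: Av.
Qed.

Lemma measurable_cell c d y : measurable (cell c d y).
Proof.
exact: (@measurable_box (fun i =>
  [set` `[c ord0 i + d * y ord0 i, c ord0 i + d * (y ord0 i + 1)[])).
Qed.

Lemma lebesgue_cell c d y : 0 <= d ->
  lebesgue_rV n (cell c d y) = (d ^+ n)%:E.
Proof.
move=> d0; rewrite (lebesgue_rV_box (A := fun i =>
  [set` `[c ord0 i + d * y ord0 i, c ord0 i + d * (y ord0 i + 1)[]))//.
rewrite (eq_bigr (fun=> d%:E)) => [|i _].
  by rewrite prodEFin prodr_const card_ord.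
rewrite lebesgue_measure_itv/= lte_fin ltrD2l mulrDr mulr1 ltrDl.
rewrite -EFinB; case: ltP => [_|]; first by congr EFin; ring.
by move=> d0'; congr EFin; apply/le_anti/andP.
Qed.

Lemma cell_inj c d y z w : 0 < d -> Zlattice y -> Zlattice z ->
  cell c d y w -> cell c d z w -> y = z.
Proof.
move=> d0 Zy Zz yw zw; apply/rowP => i.
have := yw i; have := zw i; rewrite !in_itv/= -!lerBrDl -!ltrBlDl.
move=> /andP[zl zr] /andP[yl yr].
have := le_lt_trans zl yr; have := le_lt_trans yl zr.
rewrite !ltr_pM2l//.
have /intrP[k ->] := Zy i; have /intrP[l ->] := Zz i.
rewrite -!intrD1 !ltr_int !ltzD1 => kl lk.
by congr _%:~R; apply/le_anti/andP.
Qed.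

Lemma cell_cover c d w : 0 < d -> exists2 y, Zlattice y & cell c d y w.
Proof.
move=> d0.
exists (\row_i (Num.floor ((w ord0 i - c ord0 i) / d))%:~R) => i; rewrite ?mxE.
  exact: intr_int.
rewrite in_itv/= -!lerBrDl -!ltrBlDl ![d * _]mulrC.
rewrite -ler_pdivlMr// -ltr_pdivrMr//.
have := floor_itv ((w ord0 i - c ord0 i) / d).
by rewrite intrD1.
Qed.

(** The link between sums and integrals: it integrates to the cell volume times the sum of [a],
    while at each point at most one term survives, as cells of distinct lattice points are
    disjoint. *)
Let step S (a : 'rV[R]_n -> R) c d w :=
  (\sum_(y \in S) (a y)%:E * (\1_(cell c d y) w)%:E)%E.

Let integral_step S a c d : 0 < d -> finite_set S -> (forall y, 0 <= a y) ->
  (\int[lebesgue_rV n]_w step S a c d w)%E = (d ^+ n * \sum_(y \in S) a y)%:E.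
Proof.
move=> d0 fS a0; rewrite /step ge0_integral_fsum//; last 2 first.
  move=> y; apply: measurable_funeM; apply/measurable_EFinP.
  by apply: measurable_indic; exact: measurable_cell.
  by move=> y w _; rewrite mule_ge0 ?lee_fin.
rewrite mulr_fsumr -fsumEFin//; apply: eq_fsbigr => y _.
rewrite ge0_integralZl_EFin//; last first.
  by apply/measurable_EFinP; apply: measurable_indic; exact: measurable_cell.
rewrite integral_indic//; last exact: measurable_cell.
rewrite setIT EFinM [RHS]muleC; congr (_ * _)%E.
exact: lebesgue_cell (ltW d0).
Qed.

Let stepE S a c d y w : 0 < d -> S `<=` Zlattice -> finite_set S ->
  Zlattice y -> cell c d y w ->
  step S a c d w = if y \in S then (a y)%:E else 0%E.
Proof.
move=> d0 SZ fS Zy yw.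
have other z : (S `\ y) z -> ((a z)%:E * (\1_(cell c d z) w)%:E)%E = 0%E.
  move=> [/SZ Zz /eqP zy]; rewrite indicE memNset ?mule0// => zw.
  by move/eqP : zy; apply; apply: cell_inj Zy zw yw.
rewrite /step; case: ifPn => Sy.
  rewrite (fsbigD1 y)/=; [|exact: fS|exact/set_mem].
  by rewrite fsbig1// adde0 indicE mem_set// mule1.
apply: fsbig1 => z Sz; apply: other; split => // zy.
by move: Sy; rewrite -zy notin_setE.
Qed.

Let step_ge0 S a c d w : (forall y, 0 <= a y) -> (0 <= step S a c d w)%E.
Proof.
by move=> a0; apply: fsume_ge0 => y _; rewrite mule_ge0 ?lee_fin.
Qed.

Section comparison.
Variables (S K : set 'rV[R]_n) (a F : 'rV[R]_n -> R) (c : 'rV[R]_n) (d : R).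
Hypotheses (d_gt0 : 0 < d) (SZ : S `<=` Zlattice) (fS : finite_set S).
Hypotheses (a_ge0 : forall y, 0 <= a y) (F_ge0 : forall w, K w -> 0 <= F w).

(** Every point of [K] lies in exactly one lattice cell, so the hypothesis puts [F], extended by 0,
    below the step function everywhere. *)
Lemma integral_le_cell_sum :
  (forall w y, K w -> Zlattice y -> cell c d y w -> S y /\ F w <= a y) ->
  (\int[lebesgue_rV n]_(w in K) (F w)%:E <= (d ^+ n * \sum_(y \in S) a y)%:E)%E.
Proof.
move=> KS; rewrite -(integral_step c)//; apply: ge0_le_integral_restrict.
- by move=> w Kw; rewrite lee_fin F_ge0.
- by move=> w _; exact: step_ge0.
move=> w; rewrite patch_setT patchE; case: ifPn => [/set_mem Kw|_]; last exact: step_ge0.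
have [y Zy yw] := cell_cover c w d_gt0.
rewrite (stepE _ d_gt0 SZ fS Zy yw).
by have [Sy aF] := KS _ _ Kw Zy yw; rewrite mem_set.
Qed.

Lemma cell_sum_le_integral :
  (forall w y, S y -> cell c d y w -> K w /\ a y <= F w) ->
  ((d ^+ n * \sum_(y \in S) a y)%:E <= \int[lebesgue_rV n]_(w in K) (F w)%:E)%E.
Proof.
move=> SK; rewrite -(integral_step c)//; apply: ge0_le_integral_restrict.
- by move=> w _; exact: step_ge0.
- by move=> w Kw; rewrite lee_fin F_ge0.
move=> w; rewrite patch_setT.
have [y Zy yw] := cell_cover c w d_gt0.
rewrite (stepE _ d_gt0 SZ fS Zy yw); case: ifPn => [/set_mem Sy|_].
  by have [Kw aF] := SK _ _ Sy yw; rewrite patchE mem_set.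
by rewrite patchE; case: ifPn => // /set_mem /F_ge0; rewrite lee_fin.
Qed.

End comparison.

End cells.

(** * Convex combinations and cubes inside convex sets of full dimension *)

Section convexity.
Context {R : realType} {n : nat}.
Implicit Types (K : set 'rV[R]_n) (f : 'rV[R]_n -> R) (c v x y : 'rV[R]_n).

Lemma convex_combination K x y (t : R) : convex_set K -> K x -> K y ->
  0 <= t -> t <= 1 -> K (t *: x + (1 - t) *: y).
Proof.
move=> cK Kx Ky t0 t1.
by have := cK x y (Itv01 t0 t1) (mem_set Kx) (mem_set Ky); rewrite inE.
Qed.

Lemma concave_combination K f x y (t : R) : concave_function K f -> K x -> K y ->
  0 <= t -> t <= 1 -> t * f x + (1 - t) * f y <= f (t *: x + (1 - t) *: y).
Proof.
by move=> cf Kx Ky t0 t1; exact: cf (Itv01 t0 t1) x y (mem_set Kx) (mem_set Ky).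
Qed.

Lemma convex_sum K (I : finType) (b : I -> 'rV[R]_n) (w : I -> R) :
  convex_set K -> (forall i, K (b i)) -> (forall i, 0 <= w i) ->
  \sum_i w i = 1 -> K (\sum_i w i *: b i).
Proof.
move=> cK Kb w0 w1.
have [i0 _] : exists i : I, true.
  apply/existsP; apply: contra_eqT w1 => /existsPn noI.
  by rewrite big1 ?(eq_sym 0) ?oner_neq0// => i; have := noI i.
(* Each partial sum is its total weight times some point of [K]; this form survives a total weight
   of 0, where any point of [K] will do. *)
suff key s : 0 <= \sum_(i <- s) w i /\ exists2 k, K k &
    \sum_(i <- s) w i *: b i = (\sum_(i <- s) w i) *: k.
  by have [_ [k Kk ->]] := key (index_enum I); rewrite w1 scale1r.
elim: s => [|i s [s0 [k Kk IH]]].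
  by rewrite !big_nil; split => //; exists (b i0); rewrite ?scale0r.
rewrite !big_cons IH; set S := \sum_(_ <- _) _ in s0 *; set W := w i + S.
have W0 : 0 <= W by rewrite addr_ge0.
split => //; have [WE|Wn0] := eqVneq W 0.
  exists k => //; have := w0 i; rewrite WE scale0r.
  have -> : w i = - S by apply/eqP; rewrite -subr_eq0 opprK; apply/eqP.
  rewrite oppr_ge0 => S0; have -> : S = 0 by apply/le_anti/andP.
  by rewrite oppr0 !scale0r addr0.
exists ((w i / W) *: b i + (1 - w i / W) *: k).
  apply: convex_combination; rewrite ?divr_ge0//.
  by rewrite ler_pdivrMr ?mul1r ?lerDl// lt0r Wn0.
have SE : S = W - w i by rewrite /W addrC addKr.
by rewrite scalerDr !scalerA SE; congr (_ *: _ + _ *: _); field.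
Qed.

(** A cube in the sup norm, because the displacements to be absorbed come from cells and are bounded
    coordinate by coordinate. *)
Definition inner_box K c (r : R) :=
  0 < r /\ forall v, (forall i, `|v ord0 i| <= r) -> K (c + v).

(* Write 0 and the standard basis vectors as affine combinations of points of K:
   the barycenter of all the points involved has a cube around it inside K. *)
Lemma full_dim_inner_box K : convex_set K -> has_dim K n ->
  exists c r, inner_box K c r.
Proof.
move=> cK [x0 [V [hullE dimV]]].
have hullT x : affine_hull K x.
  rewrite hullE; exists (x - x0); last by rewrite addrC subrK.
  rewrite /=; suff /eqP -> : (V == fullv)%VS by rewrite memvf.
  by rewrite eqEdim subvf dimvf dimV /dim/= mul1n.
(* Index 0 stands for the origin, the others for the standard basis vectors. *)
pose p (k : 'I_n.+1) : 'rV[R]_n :=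
  if unlift ord0 k is Some i then delta_mx 0 i else 0.
have /choice[h hP] : forall k, exists h : {m & ('I_m -> 'rV[R]_n) * ('I_m -> R)}%type,
    [/\ forall j, K ((projT2 h).1 j), \sum_j (projT2 h).2 j = 1 &
     p k = \sum_j (projT2 h).2 j *: (projT2 h).1 j].
  move=> k; have [m [a [w [Ka w1 pE]]]] := hullT (p k).
  by exists (existT _ m (a, w)).
pose I : finType := {k : 'I_n.+1 & 'I_(projT1 (h k))}.
pose b (q : I) := (projT2 (h (tag q))).1 (tagged q).
pose w (q : I) := (projT2 (h (tag q))).2 (tagged q).
have Kb q : K (b q) by have [Kh _ _] := hP (tag q); exact: Kh.
pose N : R := #|{: I}|%:R.
have N0 : 0 < N.
  have [_ w1 _] := hP ord0; rewrite ltr0n; apply/card_gt0P.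
  have [j _] : exists j : 'I_(projT1 (h ord0)), true.
    apply/existsP; apply: contra_eqT w1 => /existsPn noI.
    by rewrite big1 ?(eq_sym 0) ?oner_neq0// => j; have := noI j.
  by exists (existT _ ord0 j).
pose W : R := 1 + \sum_q `|w q|.
have W0 : 0 < W by rewrite ltr_pwDl// sumr_ge0.
(* [W] bounds every [w q], and the coefficients [s k] below are at most [n.+1 * r]; hence each
   perturbation [s * w] is at most [N^-1] and the perturbed weights stay nonnegative. *)
pose r := (N * n.+1%:R * W)^-1.
have r0 : 0 < r by rewrite invr_gt0 !mulr_gt0.
exists (\sum_(q : I) N^-1 *: b q), r; split => // v vr.
(* Coefficients of [v] on the points [p]. The one at the origin does not affect [v] and is chosen to
   make the total 0, so that adding [v] keeps the total weight 1. *)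
pose s (k : 'I_n.+1) : R :=
  if unlift ord0 k is Some i then v ord0 i else - \sum_i v ord0 i.
have sum_s : \sum_k s k = 0.
  rewrite big_ord_recl /s unlift_none; under [X in _ + X]eq_bigr do rewrite liftK.
  by rewrite addNr.
have sum_sp : \sum_k s k *: p k = v.
  rewrite big_ord_recl /s /p unlift_none scaler0 add0r.
  under eq_bigr do rewrite liftK.
  by rewrite -row_sum_delta.
have s_le k : `|s k| <= n.+1%:R * r.
  have rn : r <= n.+1%:R * r by apply: ler_peMl; rewrite ?ler1n// ltW.
  rewrite /s; case: unlift => [i|]; first exact: le_trans (vr i) rn.
  rewrite normrN (le_trans (ler_norm_sum _ _ _))//.
  rewrite (le_trans (ler_sum _ (fun i _ => vr i)))//.
  by rewrite sumr_const card_ord -[leLHS]mulr_natl ler_pM2r// ler_nat.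
rewrite (_ : _ + v = \sum_(q : I) (N^-1 + s (tag q) * w q) *: b q); last first.
  under [RHS]eq_bigr do rewrite scalerDl.
  rewrite big_split/=; congr (_ + _); rewrite -[LHS]sum_sp.
  transitivity (\sum_k \sum_(j < projT1 (h k))
     (s k * (projT2 (h k)).2 j) *: (projT2 (h k)).1 j); last first.
    exact: (@sig_big_dep _ _ _ _ _ predT (fun=> predT)).
  apply: eq_bigr => k _; have [_ _ ->] := hP k.
  by rewrite scaler_sumr; apply: eq_bigr => j _; rewrite scalerA.
apply: convex_sum => // [q|].
  rewrite -lerBlDl sub0r lerNl (le_trans (ler_norm _))// normrN normrM.
  have wW : `|w q| <= W.
    by rewrite /W (bigD1 q)//= addrCA lerDl addr_ge0// sumr_ge0.
  rewrite (le_trans (ler_pM _ _ (s_le _) wW))//.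
  by rewrite /r le_eqVlt; apply/orP; left; apply/eqP; field; rewrite !gt_eqF.
rewrite big_split/= sumr_const -mulr_natl -/N divff ?gt_eqF//.
rewrite -[RHS]addr0; congr (_ + _).
transitivity (\sum_k \sum_(j < projT1 (h k)) s k * (projT2 (h k)).2 j).
  by rewrite (@sig_big_dep _ _ _ _ _ predT (fun=> predT)).
rewrite -[RHS]sum_s; apply: eq_bigr => k _; have [_ w1 _] := hP k.
by rewrite -mulr_sumr w1 mulr1.
Qed.

End convexity.

(** * Homotheties of a convex body, near-maximal interior points, measurability, finiteness of
    lattice points *)

Section convex_body.
Context {R : realType} {n : nat}.
Implicit Types (K : set 'rV[R]_n) (f : 'rV[R]_n -> R) (c u x : 'rV[R]_n).

Lemma rV_norm_leP x (B : R) : 0 <= B ->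
  reflect (forall i, `|x ord0 i| <= B) (`|x| <= B).
Proof.
move=> B0; rewrite [X in X <= B]/Num.norm /= mx_normrE; apply: (iffP (bigmax_leP _ _ _ _)).
  by move=> [_ xB] i; exact: (xB (ord0, i)).
by move=> xB; split => // -[j i] _ /=; rewrite (ord1 j).
Qed.

Lemma bounded_setP K : bounded_set K <->
  exists2 B : R, 0 < B & forall x i, K x -> `|x ord0 i| <= B.
Proof.
split=> [[B [_ KB]]|[B B0 KB]].
  exists (`|B| + 1) => [|x i Kx]; first by rewrite ltr_wpDl.
  have KB1 : `|x| <= `|B| + 1.
    by apply: KB => //; rewrite ltr_pwDr// ler_norm.
  by apply: (rV_norm_leP x _ KB1); rewrite addr_ge0.
exists B; split => [|D BD x Kx]; first exact: num_real.
apply: le_trans (ltW BD); apply/rV_norm_leP; first exact: ltW.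
by move=> i; exact: KB.
Qed.

(** Displays the shrunken point as a convex combination of [x] and a point that lies in the cube
    around [c] as soon as [u] is at most [(E - 1) * r]. *)
Let shrinkE c x u (E : R) : 1 < E ->
  c + E^-1 *: (x - c + u) =
  E^-1 *: x + (1 - E^-1) *: (c + (E - 1)^-1 *: u).
Proof.
move=> E1; apply/rowP => i; rewrite !mxE; field.
by rewrite subr_eq0 !gt_eqF// (lt_trans ltr01).
Qed.

Section shrink.
Variables (K : set 'rV[R]_n) (c : 'rV[R]_n) (r E : R).
Hypotheses (cK : convex_set K) (cr : inner_box K c r) (E1 : 1 < E).

Let E0 : 0 < E. Proof. exact: lt_trans ltr01 E1. Qed.

Let box_scaled u : (forall i, `|u ord0 i| <= (E - 1) * r) ->
  K (c + (E - 1)^-1 *: u).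
Proof.
move=> ur; apply: cr.2 => i.
rewrite mxE normrM ger0_norm ?invr_ge0 ?subr_ge0 ?(ltW E1)//.
by rewrite ler_pdivrMl ?subr_gt0.
Qed.

Lemma shrink_inner_box x u :
  K x -> (forall i, `|u ord0 i| <= (E - 1) * r) ->
  K (c + E^-1 *: (x - c + u)).
Proof.
move=> Kx ur; rewrite shrinkE//; apply: convex_combination => //.
- exact: box_scaled.
- by rewrite invr_ge0 ltW.
- by rewrite invf_le1// ltW.
Qed.

(** Concavity along the same combination: [x] has weight [E^-1], and the term from the cube is
    nonnegative. *)
Lemma concave_shrink f x u :
  concave_function K f -> nonneg_on K f ->
  K x -> (forall i, `|u ord0 i| <= (E - 1) * r) ->
  f x <= E * f (c + E^-1 *: (x - c + u)).
Proof.
move=> cf f0 Kx ur; rewrite -ler_pdivrMl// shrinkE//.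
have Ebox := box_scaled ur.
have EV1 : E^-1 <= 1 by rewrite invf_le1// ltW.
have EV0 : 0 <= E^-1 by rewrite invr_ge0 ltW.
apply: le_trans (concave_combination cf Kx Ebox EV0 EV1).
by rewrite lerDl mulr_ge0 ?subr_ge0// f0// mem_set.
Qed.

End shrink.

(** A near-maximizer may lie on the boundary; moving it slightly towards [c0] costs a small factor
    of [f] and gains a small cube. *)
Lemma near_max_inner_box K f c0 (r0 E : R) :
  convex_set K -> bounded_set K -> concave_function K f -> nonneg_on K f ->
  inner_box K c0 r0 -> 1 < E ->
  exists c r, inner_box K c r /\ forall x, K x -> f x <= E * f c.
Proof.
move=> cK /bounded_setP[B B0 KB] cf f0 cr0 E1; have [r0_gt0 Kbox] := cr0.
have E0 : 0 < E := lt_trans ltr01 E1.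
have f_ge0 x : K x -> 0 <= f x by move=> Kx; apply: f0; rewrite mem_set.
have Kc0 : K c0.
  by rewrite -[c0]addr0; apply: Kbox => i; rewrite mxE normr0 ltW.
have ubf : has_ubound [set f x | x in K].
  (* Chosen so that [s / (1 - s) = r0 / (2 * B)]: the point [y] opposite to [x] with respect to [c0]
     then stays in the cube, and [c0], lying between [x] and [y], bounds [f x] by concavity. *)
  pose s := r0 / (2 * B + r0).
  have D0 : 0 < 2 * B + r0 by rewrite addr_gt0// mulr_gt0.
  have s0 : 0 < s by rewrite divr_gt0.
  have s1 : s < 1 by rewrite ltr_pdivrMr// mul1r ltrDr mulr_gt0.
  exists (s^-1 * f c0) => _ [x Kx <-].
  rewrite ler_pdivlMl//.
  pose y := c0 + (- (s / (1 - s))) *: (x - c0).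
  have Ky : K y.
    apply: Kbox => i; rewrite !mxE normrM normrN.
    have q0 : 0 <= s / (1 - s) by rewrite divr_ge0 ?subr_ge0 ?ltW.
    rewrite (ger0_norm q0).
    have -> : s / (1 - s) = r0 / (2 * B).
      by rewrite /s; field; do ?[apply/andP; split]; rewrite gt_eqF//; lra.
    rewrite mulrAC ler_pdivrMr ?mulr_gt0// ler_pM2l//.
    rewrite (le_trans (ler_normB _ _))// mulr_natl mulr2n.
    by rewrite lerD ?KB.
  have := concave_combination cf Kx Ky (ltW s0) (ltW s1).
  have -> : s *: x + (1 - s) *: y = c0.
    apply/rowP => i; rewrite !mxE; field.
    by rewrite subr_eq0 eq_sym lt_eqF.
  apply: le_trans; rewrite lerDl mulr_ge0 ?f_ge0//.
  by rewrite subr_ge0 ltW.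
pose m := sup [set f x | x in K].
have f_le x : K x -> f x <= m.
  by move=> Kx; apply: ub_le_sup => //; exists x.
have [m0|m_gt0] := leP m 0.
  exists c0, r0; split => // x Kx; apply: (le_trans (f_le x Kx)).
  by rewrite (le_trans m0)// mulr_ge0 ?f_ge0// ltW.
(* Then [(1 - e) ^+ 2 = E^-1 + e ^+ 2], which is at least [E^-1]: one factor [1 - e] pays for
   near-maximality, the other for the move towards [c0]. *)
pose e := (1 - E^-1) / 2.
have EV1 : E^-1 < 1 by rewrite invf_lt1.
have EV0 : 0 < E^-1 by rewrite invr_gt0.
have e0 : 0 < e by rewrite divr_gt0// subr_gt0.
have e1 : e < 1 by rewrite /e; lra.
have hs : has_sup [set f x | x in K] by split => //; exists (f c0); exists c0.
have [_ [x1 Kx1 <-] fx1] := sup_adherent (mulr_gt0 e0 m_gt0) hs.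
have e_le1 : 1 - e <= 1 by rewrite gerBl ltW.
have e_ge0 : 0 <= 1 - e by rewrite subr_ge0 ltW.
exists ((1 - e) *: x1 + (1 - (1 - e)) *: c0), (e * r0); split.
  split => [|v vr]; first exact: mulr_gt0.
  have -> : (1 - e) *: x1 + (1 - (1 - e)) *: c0 + v =
      (1 - e) *: x1 + (1 - (1 - e)) *: (c0 + e^-1 *: v).
    by apply/rowP => i; rewrite !mxE; field; rewrite gt_eqF.
  apply: convex_combination => //; apply: Kbox => i.
  have eV0 : 0 <= e^-1 by rewrite invr_ge0 ltW.
  by rewrite mxE normrM (ger0_norm eV0) ler_pdivrMl.
move=> x Kx; apply: (le_trans (f_le x Kx)).
have := concave_combination cf Kx1 Kc0 e_ge0 e_le1.
move=> /(le_trans _) h; rewrite -ler_pdivrMl//; apply: h.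
have : (1 - e) * (m - e * m) <= (1 - e) * f x1.
  by rewrite ler_wpM2l// ltW.
have : 0 <= (1 - (1 - e)) * f c0 by rewrite mulr_ge0 ?f_ge0// subKr ltW.
have : E^-1 * m <= (1 - e) * (m - e * m).
  have -> : (1 - e) * (m - e * m) = (E^-1 + e ^+ 2) * m by rewrite /e; field; lra.
  by rewrite ler_pM2r// lerDl sqr_ge0.
lra.
Qed.

(* K is the intersection over k of the union of the cells of side 1/(k+1) that
   meet K. *)
Lemma closed_measurable_rV K : closed K -> measurable K.
Proof.
move=> clK.
(* Indexing by integer vectors, a countable type, makes the unions of cells countable. *)
pose cl (k : nat) (z : 'rV[int]_n) : set 'rV[R]_n :=
  cell 0 k.+1%:R^-1 (map_mx intr z).
pose F k z := [set w | cl k z w /\ cl k z `&` K !=set0].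
have mF k z : measurable (F k z).
  have [Kz|Kz] := pselect (cl k z `&` K !=set0).
    rewrite (_ : F k z = cl k z); first exact: measurable_cell.
    by apply/seteqP; split => w // [].
  rewrite (_ : F k z = set0); first exact: measurable0.
  by apply/seteqP; split => w // [].
rewrite (_ : K = \bigcap_k \bigcup_z F k z).
  apply: bigcap_measurableType => k _; apply: countable_bigcupT_measurable => //.
apply/seteqP; split => w.
  move=> Kw k _; have k0 : 0 < k.+1%:R^-1 :> R by rewrite invr_gt0.
  have [y Zy yw] := cell_cover 0 w k0.
  have yE : y = map_mx intr (\row_i Num.floor (y ord0 i)).
    by apply/rowP => i; rewrite !mxE floorK.
  rewrite yE in yw; eexists; first by [].
  by split; [exact: yw | exists w].
move=> Fw; apply: clK => B /nbhs_ballP[e /= e0 eB].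
have [k ke] : exists k : nat, k.+1%:R^-1 < e.
  exists (Num.truncn e^-1); rewrite invf_plt ?posrE//.
  exact: truncnS_gt.
have [z _ [zw [x [zx Kx]]]] := Fw k I.
exists x; split => //; apply: eB; split => // j i; rewrite (ord1 j).
have := zw i; have := zx i; rewrite /ball /= !in_itv/= !mxE mulrDr mulr1.
set a := _ * _; move: ke; set d := _^-1 => ke.
rewrite ltr_norml; lra.
Qed.

Lemma finite_bounded_Zlattice K : bounded_set K -> finite_set (K `&` Zlattice).
Proof.
move=> /bounded_setP[B B0 KB].
(* Integer coordinates lie strictly between [-N] and [N]; shifting by [N] turns them into ordinals
   below [N + N + 1]. *)
pose N := (Num.truncn B).+1.
pose h (t : 'rV['I_(N + N).+1]_n) : 'rV[R]_n :=
  \row_i ((t ord0 i)%:R - N%:R).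
apply: (@sub_finite_set _ _ (h @` setT)); last first.
  by apply: finite_image; exact: (sub_finite_set _ (finite_finpred predT)).
move=> x [Kx Zx].
exists (\row_i inord (absz (Num.floor (x ord0 i) + N%:Z))) => //.
apply/rowP => i; rewrite !mxE.
have := KB x i Kx; have /intrP[k ->] := Zx i; rewrite intrKfloor => kB.
have : `|k%:~R : R| < N%:R by apply: le_lt_trans kB _; exact: truncnS_gt.
rewrite -intr_norm -[N%:R]/(N%:Z%:~R) ltr_int ltr_norml => /andP[Nk kN].
have kN0 : 0 <= k + N%:Z by lia.
rewrite inordK; last by lia.
by rewrite -[X in X - _]/((absz (k + N%:Z))%:Z%:~R) gez0_abs// intrD addrK.
Qed.

End convex_body.

(** * The dilated body: its lattice sums against integrals over [K] *)

Section dilated_body.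
Context {R : realType} {n : nat}.
Variables (K : set 'rV[R]_n) (f : 'rV[R]_n -> R) (c : 'rV[R]_n) (r E : R).
Hypotheses (kK : compact K) (cK : convex_set K).
Hypotheses (cf : concave_function K f) (f0 : nonneg_on K f).
Hypotheses (cr : inner_box K c r) (E1 : 1 < E) (E2 : E <= 2).
Hypothesis f_max : forall x, K x -> f x <= E * f c.

Let E0 : 0 < E. Proof. exact: lt_trans ltr01 E1. Qed.
Let r0 : 0 < r. Proof. by case: cr. Qed.

(* Chosen so that 2 / dilation, which bounds the displacements occurring in the
   cell comparisons below, is (E - 1) r. *)
Definition dilation : R := 2 / ((E - 1) * r).
Local Notation lam := dilation.

Let lam0 : 0 < lam.
Proof. by rewrite divr_gt0// mulr_gt0// subr_gt0. Qed.

Definition dilated_body : set 'rV[R]_n := [set y | K (c + lam^-1 *: y)].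

Definition dilated_fun (y : 'rV[R]_n) : R :=
  Num.min (f (c + lam^-1 *: y)) (f c).

Local Notation M := dilated_body.
Local Notation g := dilated_fun.

Let Kc : K c.
Proof.
case: cr => _ Kbox; rewrite -[c]addr0.
by apply: Kbox => i; rewrite mxE normr0 ltW.
Qed.

Let f_ge0 x : K x -> 0 <= f x. Proof. by move=> Kx; apply: f0; rewrite mem_set. Qed.

Let dilate_comb (t : R) x y :
  c + lam^-1 *: (t *: x + (1 - t) *: y) =
  t *: (c + lam^-1 *: x) + (1 - t) *: (c + lam^-1 *: y).
Proof. by apply/rowP => i; rewrite !mxE; ring. Qed.

Lemma dilated_body0 : M 0.
Proof. by rewrite /M /= scaler0 addr0. Qed.

Lemma convex_dilated_body : convex_set M.
Proof.
move=> x y t /set_mem Mx /set_mem My; apply/mem_set.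
have := convex_combination cK Mx My (ge0 t) (le1 t).
by rewrite -dilate_comb => h; exact: h.
Qed.

Lemma bounded_dilated_body : bounded_set M.
Proof.
have /bounded_setP[B B0 KB] := compact_bounded kK.
apply/bounded_setP; exists (lam * (2 * B)) => [|y i My].
  by rewrite mulr_gt0// mulr_gt0.
have lV0 : 0 <= lam^-1 by rewrite invr_ge0 ltW.
rewrite -ler_pdivrMl// -(ger0_norm lV0) -normrM.
have := KB _ i My; have := KB _ i Kc; rewrite !mxE.
rewrite !ler_norml => /andP[c1 c2] /andP[cy1 cy2].
by apply/andP; split; lra.
Qed.

Lemma dilated_fun_ge0 : nonneg_on M g.
Proof. by move=> y /set_mem My; rewrite le_min !f_ge0. Qed.

(** A minimum of two concave functions: [f] after an affine map, and a constant. *)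
Lemma concave_dilated_fun : concave_function M g.
Proof.
move=> t x y /set_mem Mx /set_mem My.
have t0 : 0 <= t%:num by exact: ge0.
have t_le1 : t%:num <= 1 by exact: le1.
have t1 : 0 <= 1 - t%:num by rewrite subr_ge0.
have := concave_combination cf Mx My t0 t_le1.
rewrite -dilate_comb => fconc.
rewrite [leLHS](_ : _ = t%:num * g x + (1 - t%:num) * g y)//.
rewrite [leRHS](_ : _ = g (t%:num *: x + (1 - t%:num) *: y))//.
have gl z : g z <= f (c + lam^-1 *: z) by rewrite ge_min lexx.
have gr z : g z <= f c by rewrite ge_min lexx orbT.
rewrite le_min; apply/andP; split.
  by apply: le_trans fconc; rewrite lerD// ler_wpM2l.
have -> : f c = t%:num * f c + (1 - t%:num) * f c by ring.
by rewrite lerD// ler_wpM2l.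
Qed.

Lemma dilated_fun_max : (g 0)%:E = supremum_on M g.
Proof.
have g0E : g 0 = f c by rewrite /g scaler0 addr0 minxx.
apply/le_anti/andP; split.
  by apply: ereal_sup_ubound; exists 0 => //; exact: dilated_body0.
by apply: ge_ereal_sup => _ [y My <-]; rewrite lee_fin g0E ge_min lexx orbT.
Qed.

Let boxE : (E - 1) * r = 2 * lam^-1.
Proof. by rewrite /lam invf_div mulrCA divff// mulr1. Qed.

(** The homothety of ratio [E^-1] moves [w] to within reach of [c + lam^-1 *: y]; the remaining
    displacement [u] is at most the cell side, and [E <= 2] makes that at most [(E - 1) * r]. The
    truncated value [f c] is handled by [f_max]. *)
Lemma cell_lower w y : K w -> cell c (E / lam) y w -> M y /\ f w <= E * g y.
Proof.
move=> Kw yw.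
pose u := (E / lam) *: y - (w - c).
have cE : c + E^-1 *: (w - c + u) = c + lam^-1 *: y.
  rewrite /u [w - c + _]addrC subrK; congr (c + _).
  by rewrite scalerA mulrA mulVf ?mul1r// gt_eqF.
have ur i : `|u ord0 i| <= (E - 1) * r.
  have l2 : E / lam <= 2 * lam^-1 by rewrite ler_pM2r// invr_gt0.
  have := yw i; rewrite in_itv/= boxE /u !mxE mulrDr mulr1.
  set a := _ * y _ _; set b := E / lam in l2 *.
  by rewrite ler_norml => /andP[]; lra.
split; first by rewrite /M /= -cE; exact: (shrink_inner_box cK cr E1).
rewrite /g minEle; case: ifP => _; last exact: f_max.
by have := concave_shrink cr E1 cf f0 Kw ur; rewrite cE.
Qed.

(** Here the homothety leads from the point of [y + u] to [w]. In units of [lam^-1] the displacement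
    [v] is at most 1 from the cell plus 1 from [u], whence the 2 in [dilation]. *)
Let cell_upper_shift w y u : cell c (lam * E)^-1 y w -> open_cube u -> M (y + u) ->
  K w /\ g (y + u) <= E * f w.
Proof.
move=> yw u1 Myu; set x := c + lam^-1 *: (y + u).
have Kx : K x by [].
pose v := E *: (w - c) - lam^-1 *: (y + u).
have wE : c + E^-1 *: (x - c + v) = w.
  apply/rowP => i; rewrite !mxE; field.
  by rewrite !gt_eqF.
have vr i : `|v ord0 i| <= (E - 1) * r.
  have lE_gt0 := mulr_gt0 lam0 E0.
  have /andP[u1l u1r] := u1 i; have := yw i; rewrite in_itv/= => /andP[wl wr].
  have {}wl : y ord0 i <= (w ord0 i - c ord0 i) * (lam * E).
    by rewrite -ler_pdivrMr// mulrC lerBrDl.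
  have {}wr : (w ord0 i - c ord0 i) * (lam * E) < y ord0 i + 1.
    by rewrite -ltr_pdivlMr// ltrBlDl mulrC.
  rewrite boxE /v !mxE.
  have l0 : 0 < lam^-1 by rewrite invr_gt0.
  set s := w ord0 i - _ in wl wr *; set z := y ord0 i in wl wr *; set a := u ord0 i in u1l u1r *.
  have -> : E * s - lam^-1 * (z + a) = lam^-1 * (s * (lam * E) - z - a).
    by field; rewrite gt_eqF.
  rewrite normrM gtr0_norm// mulrC ler_pM2r// ler_norml.
  by apply/andP; split; lra.
split; first by rewrite -wE; exact: (shrink_inner_box cK cr E1).
rewrite /g ge_min -/x; apply/orP; left.
by have := concave_shrink cr E1 cf f0 Kx vr; rewrite wE.
Qed.

Lemma cell_upper w y : minkowski_sum M open_cube y -> cell c (lam * E)^-1 y w ->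
  K w /\ 0 <= diamond M g y <= E * f w.
Proof.
move=> [m Mm [u u1 myu]] yw.
have Kw : K w.
  (* The point [y] itself may lie outside [M]; the shift by [- u] leads back to [m]. *)
  have [] := @cell_upper_shift w y (- u) yw => //.
    by move=> i; rewrite mxE ltrN2 ltrNl andbC u1.
  by rewrite -myu addrK.
have cube0 : open_cube (0 : 'rV[R]_n) by move=> i; rewrite mxE ltrN10 ltr01.
(* This bound also makes the real [sup] in [diamond] a true supremum; the shift 0 shows that the set
   is nonempty. *)
have ub : ubound [set patch (fun=> 0) M g (y + v) | v in open_cube] (E * f w).
  move=> _ [v v1 <-]; rewrite patchE; case: ifPn => [/set_mem Myv|_].
    by have [] := cell_upper_shift yw v1 Myv.
  by rewrite mulr_ge0 ?f_ge0// ltW.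
split => //; apply/andP; split; last first.
  by apply: ge_sup => //; exists (patch (fun=> 0) M g (y + 0)), 0.
apply: le_trans (ub_le_sup (ex_intro _ _ ub) (ex_intro2 _ _ 0 cube0 erefl)).
by rewrite patchE; case: ifPn => // /dilated_fun_ge0.
Qed.

Lemma sub_minkowski_cube : M `<=` minkowski_sum M open_cube.
Proof.
move=> y My; exists y => //; exists 0; last by rewrite addr0.
by move=> i; rewrite mxE ltrN10 ltr01.
Qed.

Lemma bounded_minkowski_cube : bounded_set (minkowski_sum M open_cube).
Proof.
have /bounded_setP[B B0 MB] := bounded_dilated_body.
apply/bounded_setP; exists (B + 1); first by rewrite addr_gt0.
move=> _ i [m Mm [u u1 <-]]; rewrite mxE (le_trans (ler_normD _ _))//.
by rewrite lerD ?MB// ler_norml; have /andP[u1l u1r] := u1 i; rewrite !ltW.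
Qed.

Let finM : finite_set (M `&` Zlattice).
Proof. exact: finite_bounded_Zlattice bounded_dilated_body. Qed.

Let finS : finite_set (minkowski_sum M open_cube `&` Zlattice).
Proof. exact: finite_bounded_Zlattice bounded_minkowski_cube. Qed.

Let mK : measurable K.
Proof. by apply: closed_measurable_rV; exact: compact_closed. Qed.

Let G : R := (lattice_count M)%:R.

Let latticeE : \sum_(y \in M `&` Zlattice) (1 : R) = G.
Proof.
rewrite fsbig_finite//= big_const_seq count_predT iter_addr_0.
by [].
Qed.

Let volE : lebesgue_rV n K = (\int[lebesgue_rV n]_(x in K) 1%:E)%E.
Proof. by rewrite integral_cst// mul1e. Qed.

Let El0 : 0 < E / lam. Proof. by rewrite divr_gt0. Qed.
Let lE0 : 0 < (lam * E)^-1. Proof. by rewrite invr_gt0 mulr_gt0. Qed.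

(** Stated in the extended reals because it also gives the finiteness of the volume on which the use
    of [fine] rests; [integral_le_fin] does the same for the integrals. *)
Let volume_le_fin : (lebesgue_rV n K <= ((E / lam) ^+ n * G)%:E)%E.
Proof.
rewrite volE -latticeE; apply: (@integral_le_cell_sum _ _ _ _ _ _ c) => //.
by move=> w y Kw Zy yw; have [] := cell_lower Kw yw.
Qed.

Lemma volume_le : fine (lebesgue_rV n K) <= (E / lam) ^+ n * G.
Proof.
rewrite -lee_fin fineK// ge0_fin_numE ?measure_ge0//.
exact: le_lt_trans volume_le_fin (ltry _).
Qed.

Lemma volume_ge : (lam * E)^-1 ^+ n * G <= fine (lebesgue_rV n K).
Proof.
rewrite -lee_fin fineK; last first.
  rewrite ge0_fin_numE ?measure_ge0//.
  exact: le_lt_trans volume_le_fin (ltry _).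
rewrite volE -latticeE; apply: (@cell_sum_le_integral _ _ _ _ _ _ c) => //.
move=> w y [My Zy] yw.
by have [] := cell_upper (sub_minkowski_cube My) yw.
Qed.

Let integral_le_fin q : 0 < q ->
  (\int[lebesgue_rV n]_(x in K) (f x `^ q)%:E <=
  ((E / lam) ^+ n * (E `^ q * \sum_(y \in M `&` Zlattice) g y `^ q))%:E)%E.
Proof.
move=> q0; rewrite mulr_fsumr; apply: (@integral_le_cell_sum _ _ _ _ _ _ c) => //.
- by move=> y; rewrite mulr_ge0 ?powR_ge0.
- by move=> w _; rewrite powR_ge0.
move=> w y Kw Zy yw; have [My fg] := cell_lower Kw yw; split => //.
have gy0 : 0 <= g y by rewrite dilated_fun_ge0// mem_set.
rewrite -powRM ?(ltW E0)// ge0_ler_powR ?nnegrE ?mulr_ge0 ?f_ge0//; exact: ltW.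
Qed.

Let integral_fin q : 0 < q ->
  (\int[lebesgue_rV n]_(x in K) (f x `^ q)%:E)%E \is a fin_num.
Proof.
move=> q0; rewrite ge0_fin_numE.
  exact: le_lt_trans (integral_le_fin q0) (ltry _).
by apply: integral_ge0 => x _; rewrite lee_fin powR_ge0.
Qed.

Lemma integral_le q : 0 < q ->
  \int[lebesgue_rV n]_(x in K) (f x `^ q) <=
  (E / lam) ^+ n * (E `^ q * \sum_(y \in M `&` Zlattice) g y `^ q).
Proof.
by move=> q0; rewrite -lee_fin fineK ?integral_fin// integral_le_fin.
Qed.

Lemma integral_ge p : 0 < p ->
  (lam * E)^-1 ^+ n * ((E `^ p)^-1 *
    \sum_(y \in minkowski_sum M open_cube `&` Zlattice) diamond M g y `^ p) <=
  \int[lebesgue_rV n]_(x in K) (f x `^ p).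
Proof.
move=> p0; rewrite -lee_fin fineK ?integral_fin// mulr_fsumr.
apply: (@cell_sum_le_integral _ _ _ _ _ _ c) => //.
- by move=> y; rewrite mulr_ge0 ?invr_ge0 ?powR_ge0.
- by move=> w _; rewrite powR_ge0.
move=> w y [My Zy] yw; have [Kw /andP[d0 fg]] := cell_upper My yw; split => //.
rewrite ler_pdivrMl ?powR_gt0// -powRM ?f_ge0 ?(ltW E0)//.
by rewrite ge0_ler_powR ?nnegrE ?mulr_ge0 ?f_ge0// ltW.
Qed.

End dilated_body.

(** * The limit [E] to 1 and the final estimate *)

Lemma le_of_powR_factor {R : realType} (a L r : R) : 0 < a -> 0 <= r ->
  (forall E, 1 < E -> E <= 2 -> L <= E `^ a * r) -> L <= r.
Proof.
move=> a0 r0 H; rewrite leNgt; apply/negP => rL.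
have L0 : 0 < L by exact: le_lt_trans r0 rL.
(* If [r < L], this ratio of [L] to the mean of [L] and [r] exceeds 1 and still satisfies
   [s * r < L]; an [E] with [E ^ a <= s] then contradicts the hypothesis. *)
pose s := 2 * L / (L + r).
have Lr0 : 0 < L + r by rewrite ltr_wpDr.
have s1 : 1 < s by rewrite ltr_pdivlMr// mul1r; lra.
have sa1 : 1 < s `^ a^-1.
  have <- : 1 `^ a^-1 = 1 :> R by rewrite powR1.
  by rewrite gt0_ltr_powR ?invr_gt0 ?nnegrE// ltW// (lt_trans ltr01).
pose E := Num.min 2 (s `^ a^-1).
have E1 : 1 < E by rewrite lt_min sa1 ltr1n.
have := H E E1; rewrite ge_min lexx => /(_ isT); apply/negP; rewrite -ltNge.
have Es : E `^ a <= s.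
  rewrite -[leRHS]powRr1; last by rewrite ltW// (lt_trans ltr01).
  rewrite -(mulVf (lt0r_neq0 a0)) powRrM ge0_ler_powR ?nnegrE ?powR_ge0 ?(ltW a0)//.
    by rewrite ltW// (lt_trans ltr01).
  by rewrite ge_min lexx orbT.
apply: le_lt_trans (ler_wpM2r r0 Es) _.
rewrite /s mulrAC ltr_pdivrMr// -mulrA mulrCA ltr_pM2l//; lra.
Qed.

Lemma Gamma_ge0 {R : realType} (s : R) : 0 <= Gamma s.
Proof.
by apply: Rintegral_ge0 => t _; rewrite mulr_ge0 ?powR_ge0 ?expR_ge0.
Qed.

Lemma rbinomial_ge0 {R : realType} (r s : R) : 0 <= rbinomial r s.
Proof. by rewrite divr_ge0 ?mulr_ge0 ?Gamma_ge0. Qed.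

Theorem theorem4p5 (R : realType) (n : nat) (n_ge1 : (1 <= n)%N) :
  (forall (M : set 'rV[R]_n) (g : 'rV[R]_n -> R) (p q : R),
     convex_set M -> bounded_set M -> M 0 ->
     concave_function M g -> nonneg_on M g ->
     (g 0)%:E = supremum_on M g ->
     0 < p -> p < q ->
     (rbinomial (n%:R + q) n%:R / (lattice_count M)%:R *
        \sum_(x \in M `&` Zlattice) g x `^ q) `^ q^-1
     <= (rbinomial (n%:R + p) n%:R / (lattice_count M)%:R *
          \sum_(x \in minkowski_sum M open_cube `&` Zlattice) diamond M g x `^ p)
        `^ p^-1) ->
  forall (K : set 'rV[R]_n) (f : 'rV[R]_n -> R) (p q : R),
    compact K -> convex_set K -> has_dim K n ->
    concave_function K f -> nonneg_on K f ->
    0 < p -> p < q ->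
    (rbinomial (n%:R + q) n%:R / fine (lebesgue_rV n K) *
       \int[lebesgue_rV n]_(x in K) (f x `^ q)) `^ q^-1
    <= (rbinomial (n%:R + p) n%:R / fine (lebesgue_rV n K) *
         \int[lebesgue_rV n]_(x in K) (f x `^ p)) `^ p^-1.
Proof.
move=> discrete K f p q kK cK dimK cf f0 p0 pq.
have q0 : 0 < q := lt_trans p0 pq.
have [c0 [r0 c0r0]] := full_dim_inner_box cK dimK.
set V := fine _; set Iq := (\int[_]_(_ in K) (f _ `^ q)).
set Ip := (\int[_]_(_ in K) (f _ `^ p)).
set bq := rbinomial _ _; set bp := rbinomial _ _.
have bq0 : 0 <= bq by exact: rbinomial_ge0.
have bp0 : 0 <= bp by exact: rbinomial_ge0.
pose N : R := (n + n)%:R.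
(* The left side loses [E ^ (2n + q)] under a [q]-th root, the right side [E ^ (2n + p)] under a
   [p]-th root. *)
apply: (@le_of_powR_factor _ ((N + q) / q + (N + p) / p)).
- by rewrite addr_gt0// divr_gt0// ltr_wpDl.
- exact: powR_ge0.
move=> E E1 E2; have E0 : 0 < E := lt_trans ltr01 E1.
have [c [r [cr fmax]]] :=
  near_max_inner_box cK (compact_bounded kK) cf f0 c0r0 E1.
pose lam := dilation r E; pose M := dilated_body K c r E.
pose g := dilated_fun f c r E.
pose G : R := (lattice_count M)%:R.
pose Sq := \sum_(x \in M `&` Zlattice) g x `^ q.
pose Dp := \sum_(x \in minkowski_sum M open_cube `&` Zlattice) diamond M g x `^ p.
have lam0 : 0 < lam.
  by case: cr => rr0 _; rewrite divr_gt0// mulr_gt0// subr_gt0.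
have Iq_le : Iq <= (E / lam) ^+ n * (E `^ q * Sq) by exact: integral_le.
have Ip_ge : (lam * E)^-1 ^+ n * ((E `^ p)^-1 * Dp) <= Ip by exact: integral_ge.
have V_le : V <= (E / lam) ^+ n * G by exact: volume_le.
have V_ge : (lam * E)^-1 ^+ n * G <= V by exact: volume_ge.
(* The origin is a lattice point of [M]; through [V_ge] this also makes the volume positive, so all
   divisions are genuine. *)
have G0 : 0 < G.
  rewrite ltr0n cardfs_gt0; apply/fset0Pn; exists 0.
  rewrite in_fset_set; last first.
    exact/finite_bounded_Zlattice/bounded_dilated_body.
  by rewrite mem_set//; split; [exact: dilated_body0 | move=> i; rewrite mxE].
have V0 : 0 < V.
  by apply: lt_le_trans V_ge; rewrite mulr_gt0// exprn_gt0// invr_gt0 mulr_gt0.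
have Sq0 : 0 <= Sq by apply: fsumr_ge0 => x _; exact: powR_ge0.
have Dp0 : 0 <= Dp by apply: fsumr_ge0 => x _; exact: powR_ge0.
have Ip0 : 0 <= Ip by apply: Rintegral_ge0 => x _; exact: powR_ge0.
have Iq0 : 0 <= Iq by apply: Rintegral_ge0 => x _; exact: powR_ge0.
have EN : E `^ N = E ^+ n * E ^+ n by rewrite powR_mulrn ?exprD// ltW.
have powE a : E `^ (N + a) = E ^+ n * E ^+ n * E `^ a.
  by rewrite powRD ?EN// (gt_eqF E0) implybT.
pose y := (lam * E) ^+ n.
have y0 : 0 < y by rewrite exprn_gt0// mulr_gt0.
have G_le : G <= y * V by rewrite -ler_pdivrMl// -exprVn.
have Dp_le : Dp <= E `^ p * (y * Ip).
  by rewrite -ler_pdivrMl ?powR_gt0// -ler_pdivrMl// -exprVn.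
have VV_le : V^-1 <= y / G by rewrite ler_pdivlMr// ler_pdivrMl// mulrC.
have GV_le : G^-1 <= (E / lam) ^+ n / V.
  by rewrite ler_pdivlMr// ler_pdivrMl// mulrC.
(* The two cell sizes are paired so that [lam] cancels, leaving a loss in [E] alone. *)
have yE : y * (E / lam) ^+ n = E ^+ n * E ^+ n.
  by rewrite -!exprMn; congr (_ ^+ n); field; rewrite gt_eqF.
have left_le : bq / V * Iq <= E `^ (N + q) * (bq / G * Sq).
  rewrite powE -yE [leRHS](_ : _ =
    bq * (y / G) * ((E / lam) ^+ n * (E `^ q * Sq))); last by ring.
  by rewrite ler_pM// ?ler_wpM2l// mulr_ge0// invr_ge0 ltW.
have right_le : bp / G * Dp <= E `^ (N + p) * (bp / V * Ip).
  rewrite powE -yE [leRHS](_ : _ =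
    bp * ((E / lam) ^+ n / V) * (E `^ p * (y * Ip))); last by ring.
  by rewrite ler_pM// ?ler_wpM2l// mulr_ge0// invr_ge0 ltW.
have convM : convex_set M by exact: convex_dilated_body.
have bndM : bounded_set M by exact: bounded_dilated_body.
have M0 : M 0 by exact: dilated_body0.
have concg : concave_function M g by exact: concave_dilated_fun.
have g_ge0 : nonneg_on M g by exact: dilated_fun_ge0.
have gmax : (g 0)%:E = supremum_on M g by exact: dilated_fun_max.
have := discrete M g p q convM bndM M0 concg g_ge0 gmax p0 pq.
rewrite -/G -/bq -/bp -/Sq -/Dp => disc.
have qV0 : 0 <= q^-1 by rewrite invr_ge0 ltW.
have pV0 : 0 <= p^-1 by rewrite invr_ge0 ltW.
have powle (a u v : R) : 0 <= a -> 0 <= u -> u <= v -> u `^ a <= v `^ a.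
  by move=> a0 u0 uv; rewrite ge0_ler_powR ?nnegrE// (le_trans u0).
have lhs0 : 0 <= bq / V * Iq := mulr_ge0 (divr_ge0 bq0 (ltW V0)) Iq0.
have rhs0 : 0 <= bp / V * Ip := mulr_ge0 (divr_ge0 bp0 (ltW V0)) Ip0.
have Sq_ge0 : 0 <= bq / G * Sq := mulr_ge0 (divr_ge0 bq0 (ltW G0)) Sq0.
have Dp_ge0 : 0 <= bp / G * Dp := mulr_ge0 (divr_ge0 bp0 (ltW G0)) Dp0.
apply: le_trans (powle _ _ _ qV0 lhs0 left_le) _.
rewrite powRM ?powR_ge0// -powRrM powRD; last by rewrite (gt_eqF E0) implybT.
rewrite -[leRHS]mulrA ler_wpM2l ?powR_ge0//; apply: (le_trans disc).
apply: le_trans (powle _ _ _ pV0 Dp_ge0 right_le) _.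
by rewrite powRM ?powR_ge0// -powRrM.
Qed.
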